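(* The rings of characters of the Lie superalgebras $\mathfrak{pq}(n)$ and $\mathfrak{psq}(n)$ satisfy $$J\left(\mathfrak{pq}(n)\right)=J\left(\mathfrak{q}(n)\right)\cap\operatorname{span}_{\mathbb{Z}}\left\{ x^{\lambda}\;\middle|\;\lambda\in\mathbb{Z}^{n},\ \sum_{i=1}^{n}\lambda_{i}=0\right\},$$ $$J\left(\mathfrak{psq}(n)\right)=J\left(\mathfrak{sq}(n)\right)\cap\operatorname{span}_{\mathbb{Z}}\left\{ x^{\lambda}\;\middle|\;\lambda\in\mathbb{Z}^{n},\ \sum_{i=1}^{n}\lambda_{i}=0\right\}.$$
   Context: The queer Lie superalgebra $\mathfrak{q}(n)$ (over $\mathbb{C}$) is the subalgebra of $\mathfrak{gl}(n|n)$ consisting of the matrices $\begin{bmatrix}A&B\\ B&A\end{bmatrix}$ with $A,B$ arbitrary $n\times n$ matrices; the even part is given by $B=0$ and the odd part by $A=0$. The subalgebra $\mathfrak{sq}(n)\subset\mathfrak{q}(n)$ consists of those matrices with $\operatorname{tr}B=0$. Set $\mathfrak{pq}(n)=\mathfrak{q}(n)/\mathbb{C}I$ and $\mathfrak{psq}(n)=\mathfrak{sq}(n)/\mathbb{C}I$, with $I$ the identity matrix. Let $\mathfrak{h}_{\bar 0}$ be the space of matrices with $B=0$ and $A$ diagonal, with basis $H_i=E_{ii}+E_{n+i,n+i}$ and dual basis $\varepsilon_1,\dots,\varepsilon_n$ of $\mathfrak{h}_{\bar 0}^*$. Modules over $\mathfrak{pq}(n)$ (resp. $\mathfrak{psq}(n)$)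 are regarded as modules over $\mathfrak{q}(n)$ (resp. $\mathfrak{sq}(n)$) on which $I$ acts by zero. For a finite-dimensional module $M=\bigoplus_\lambda M_\lambda$ with weight spaces $M_\lambda$ ($\lambda\in\mathfrak{h}_{\bar 0}^*$), $\operatorname{ch}M=\sum_\lambda(\dim M_\lambda)e^\lambda$, where $\dim$ is the total dimension (even plus odd). For a Lie superalgebra $\mathfrak{g}$, $J(\mathfrak{g})$ is the ring of all $\mathbb{Z}$-linear combinations of characters of finite-dimensional $\mathfrak{g}$-modules. Notation: $x_i:=e^{\varepsilon_i}$ and $x^\lambda=x_1^{\lambda_1}\cdots x_n^{\lambda_n}$.
   Formalization: J(pq(n)) and J(psq(n)) are intersected with the ring of Laurent polynomials in x_1,…,x_n (integral weights): as stated the equalities fail for n ≥ 2, e.g. the natural sl(2)-module is a psq(2)-module with weights ±(ε_1−ε_2)/2, not in Z^2. *)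

(* Defs.v *)
From HB Require Import structures.
From mathcomp Require Import all_boot all_order all_algebra.
From mathcomp Require Import boolp classical_sets reals.
From mathcomp Require Import complex.

Set Implicit Arguments.
Unset Strict Implicit.
Unset Printing Implicit Defensive.

Import GRing.Theory Num.Theory.

Local Open Scope ring_scope.
Local Open Scope classical_set_scope.
Local Open Scope complex_scope.

Definition homogeneous (F : fieldType) (n : nat) (a : bool)
    (x : 'M[F]_(n + n)) : Prop :=
  if a then ulsubmx x = 0 /\ drsubmx x = 0
  else ursubmx x = 0 /\ dlsubmx x = 0.

(* The bracket of gl(n|n) on homogeneous x and y, of parities a and b. *)
Definition sbracket (F : fieldType) (n : nat) (a b : bool)
    (x y : 'M[F]_(n + n)) : 'M[F]_(n + n) :=
  x *m y - (-1) ^+ (a && b) *: (y *m x).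

(* A finite-dimensional module over a graded subalgebra g of gl(n|n).  The
   action is a linear map on g, extended arbitrarily to a linear map on all
   n+n matrices: nothing is required of its values outside g. *)
Record smodule (F : fieldType) (n : nat) (g : set 'M[F]_(n + n)) := SModule {
  smod_sort :> vectType F;
  (* even part at false, odd part at true *)
  smod_part : bool -> {vspace smod_sort};
  smod_act : {linear 'M[F]_(n + n) -> 'End(smod_sort)};
  smod_full : (smod_part false + smod_part true = fullv)%VS;
  smod_direct : (smod_part false :&: smod_part true = 0)%VS;
  smod_act_part : forall (a b : bool) (x : 'M[F]_(n + n)) (v : smod_sort),
    g x -> homogeneous a x -> v \in smod_part b ->
    smod_act x v \in smod_part (a (+) b);
  smod_act_bracket :
    forall (a b : bool) (x y : 'M[F]_(n + n)) (v : smod_sort),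
    g x -> homogeneous a x -> g y -> homogeneous b y ->
    smod_act (sbracket a b x y) v =
      smod_act x (smod_act y v)
      - (-1) ^+ (a && b) *: smod_act y (smod_act x v) }.

Definition cartanH (F : fieldType) (n : nat) (i : 'I_n) : 'M[F]_(n + n) :=
  delta_mx (lshift n i) (lshift n i) + delta_mx (rshift n i) (rshift n i).

(* A weight is given by its coordinates in the basis dual to the H_i. *)
Definition weight_space (F : fieldType) (n : nat) (g : set 'M[F]_(n + n))
    (M : smodule g) (l : 'rV[F]_n) : {vspace M} :=
  (\bigcap_(i < n) passmx.leigenspace (smod_act M (cartanH F i)) (l 0%R i))%VS.

(* M is the sum of its weight spaces; distinct weight spaces are always
   independent, so that the sum is direct. *)
Definition weight_module (F : fieldType) (n : nat) (g : set 'M[F]_(n + n))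
    (M : smodule g) : Prop :=
  exists s : seq 'rV[F]_n, (\sum_(l <- s) weight_space M l)%VS = fullv.

(* The elements of the group ring Z[h^*] are represented by their coefficient
   functions 'rV_n -> int: e^l is the indicator function of l, and ch M sends
   l to dim M_l. *)
Definition expw (F : fieldType) (n : nat) (l : 'rV[F]_n) : 'rV[F]_n -> int :=
  fun m => (m == l)%:R.

Definition ch (F : fieldType) (n : nat) (g : set 'M[F]_(n + n))
    (M : smodule g) : 'rV[F]_n -> int :=
  fun l => (\dim (weight_space M l))%:Z.

Definition zspan (T : Type) (S : set (T -> int)) : set (T -> int) :=
  [set f | exists (k : nat) (c : 'I_k -> int) (e : 'I_k -> T -> int),
     (forall i, S (e i)) /\ f = (fun t => \sum_(i < k) c i * e i t)].

(* The character ring J(g/k), for an ideal k of g: a module over g/k is a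
   g-module on which k acts by zero. *)
Definition char_ring (F : fieldType) (n : nat) (g k : set 'M[F]_(n + n)) :
    set ('rV[F]_n -> int) :=
  zspan [set f | exists M : smodule g,
    [/\ weight_module M, (forall x, k x -> smod_act M x = 0) & f = ch M]].

Definition q (R : realType) (n : nat) : set 'M[R[i]]_(n + n) :=
  [set x | exists A B : 'M[R[i]]_n, x = block_mx A B B A].

Definition sq (R : realType) (n : nat) : set 'M[R[i]]_(n + n) :=
  [set x | exists A B : 'M[R[i]]_n, \tr B = 0 /\ x = block_mx A B B A].

Definition CI (R : realType) (n : nat) : set 'M[R[i]]_(n + n) :=
  [set x | exists a : R[i], x = a%:M].

Arguments q R n : clear implicits.
Arguments sq R n : clear implicits.
Arguments CI R n : clear implicits.

Definition J_q (R : realType) (n : nat) := char_ring (q R n) [set 0].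
Definition J_sq (R : realType) (n : nat) := char_ring (sq R n) [set 0].
Definition J_pq (R : realType) (n : nat) := char_ring (q R n) (CI R n).
Definition J_psq (R : realType) (n : nat) := char_ring (sq R n) (CI R n).

Arguments J_q R n : clear implicits.
Arguments J_sq R n : clear implicits.
Arguments J_pq R n : clear implicits.
Arguments J_psq R n : clear implicits.

(* x^l for an integral l, where x_i = e^(epsilon_i). *)
Definition xpow (R : realType) (n : nat) (l : 'rV[int]_n) :
    'rV[R[i]]_n -> int :=
  expw (map_mx intr l).

Arguments xpow R {n} l.

(* Z[x_1, x_1^-1, ..., x_n, x_n^-1].  It does not contain every character: the
   weights of a finite-dimensional module need not be integral.  For instance,
   the natural sl_2-module, with odd elements acting by zero, is a module over
   psq(2) whose weights are (epsilon_1 - epsilon_2)/2 and its opposite. *)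
Definition laurent (R : realType) (n : nat) : set ('rV[R[i]]_n -> int) :=
  zspan [set xpow R l | l in [set: 'rV[int]_n]].

Arguments laurent R n : clear implicits.

(* Main.v *)
From HB Require Import structures.
Require Import Defs.
From mathcomp Require Import all_boot all_order all_algebra.
From mathcomp Require Import boolp classical_sets reals.
From mathcomp Require Import complex.

(** The identity matrix I is the sum of the H_i, so it acts on a vector of
    weight l by the scalar sum_i l_i, and this one remark drives both
    inclusions.

    If I acts by zero on M, every weight of M has coordinate sum zero.  An
    element of the character ring of the quotient by the scalars is therefore
    supported on the weights of coordinate sum zero, and if it is also a
    Laurent polynomial, only the monomials of total degree zero are left in it.

    For the converse, I is even and commutes with every matrix, hence on any
    module M the kernel of I is a graded submodule, on which the scalars act
    by zero.  When M is the sum of its weight spaces, this kernel is the sum of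
    the weight spaces of coordinate sum zero: [ker_sum_eigenvectors], applied
    to the action of I, gives [weight_module_ker1] and [ch_ker1].  Its
    character is thus the truncation of ch M to the weights of coordinate sum
    zero.  A combination of characters supported on such weights equals its own
    truncation, so each module in it may be replaced by the kernel of I.

    The argument uses of q(n) and sq(n) only that they contain I and the H_i,
    which is how [char_ring_mod_scalars] is stated. *)

Set Implicit Arguments.
Unset Strict Implicit.
Unset Printing Implicit Defensive.

Import GRing.Theory Num.Theory.

Local Open Scope ring_scope.
Local Open Scope classical_set_scope.

(** * The Cartan elements and the action of the identity matrix *)

Lemma cartanHE (F : fieldType) (n : nat) (i : 'I_n) :
  cartanH F i = block_mx (delta_mx i i) 0 0 (delta_mx i i).
Proof.
rewrite /cartanH delta_mx_ushift delta_mx_dshift.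
rewrite delta_mx_lshift delta_mx_rshift.
by rewrite add_col_mx addr0 add0r.
Qed.

Lemma sum_cartanH (F : fieldType) (n : nat) :
  \sum_(i < n) cartanH F i = 1%:M.
Proof.
rewrite scalar_mx_block mx1_sum_delta.
under eq_bigr do rewrite cartanHE.
elim/big_ind2: _ => [|A B A' B' -> ->|//]; first by rewrite block_mx0.
by rewrite add_block_mx !addr0.
Qed.

Lemma homogeneous_cartanH (F : fieldType) (n : nat) (i : 'I_n) :
  homogeneous false (cartanH F i).
Proof. by rewrite cartanHE /homogeneous /= block_mxKur block_mxKdl. Qed.

Lemma homogeneous_scalar_mx (F : fieldType) (n : nat) (a : F) :
  homogeneous false (a%:M : 'M[F]_(n + n)).
Proof.
by rewrite scalar_mx_block /homogeneous /= block_mxKur block_mxKdl.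
Qed.

Lemma mem_leigenspace (F : fieldType) (V : vectType F) (f : 'End(V)) (a : F)
    (v : V) :
  (v \in passmx.leigenspace f a) = (f v == a *: v).
Proof.
by rewrite memv_ker add_lfunE opp_lfunE scale_lfunE id_lfunE subr_eq0.
Qed.

Lemma weight_spaceP (F : fieldType) (n : nat) (g : set 'M[F]_(n + n))
    (M : smodule g) (l : 'rV[F]_n) (v : M) :
  reflect (forall i, smod_act M (cartanH F i) v = l 0 i *: v)
          (v \in weight_space M l).
Proof.
apply: (iffP subv_bigcapP) => Mlv i.
  by apply/eqP; rewrite -mem_leigenspace memvE Mlv.
by rewrite -memvE mem_leigenspace Mlv.
Qed.

(** This is where the coordinate sum of a weight enters: I is the sum of the
    H_i. *)
Lemma act1_weight (F : fieldType) (n : nat) (g : set 'M[F]_(n + n))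
    (M : smodule g) (l : 'rV[F]_n) (v : M) :
  v \in weight_space M l ->
  smod_act M 1%:M v = (\sum_(i < n) l 0 i) *: v.
Proof.
move/weight_spaceP => Mlv.
rewrite -sum_cartanH linear_sum sum_lfunE scaler_suml.
exact: eq_bigr.
Qed.

(** * Graded stable subspaces as modules *)

(** The projection onto U makes this linear in x on all matrices, including
    those outside g, which need not preserve U; for x in g it is the
    restriction of the action of x to U. *)
Definition restr_act (F : fieldType) (n : nat) (g : set 'M[F]_(n + n))
    (M : smodule g) (U : {vspace M}) (x : 'M[F]_(n + n)) :
    'End(subvs_of U) :=
  (linfun (vsproj U) \o smod_act M x \o linfun vsval)%VF.

Lemma restr_act_is_linear (F : fieldType) (n : nat) (g : set 'M[F]_(n + n))
    (M : smodule g) (U : {vspace M}) :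
  linear (restr_act U).
Proof.
move=> a x y.
by rewrite /restr_act linearP comp_lfunDr comp_lfunDl -comp_lfunZr -comp_lfunZl.
Qed.

HB.instance Definition _ (F : fieldType) (n : nat) (g : set 'M[F]_(n + n))
    (M : smodule g) (U : {vspace M}) :=
  GRing.isLinear.Build F 'M[F]_(n + n) 'End(subvs_of U) *:%R (restr_act U)
    (restr_act_is_linear U).

Lemma vsval_restr_act (F : fieldType) (n : nat) (g : set 'M[F]_(n + n))
    (M : smodule g) (U : {vspace M}) (x : 'M[F]_(n + n)) (u : subvs_of U) :
  smod_act M x (vsval u) \in U ->
  vsval (restr_act U x u) = smod_act M x (vsval u).
Proof. by move=> Uxu; rewrite !lfunE /= !lfunE /= lfunE /= vsprojK. Qed.

Definition restr_part (F : fieldType) (n : nat) (g : set 'M[F]_(n + n))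
    (M : smodule g) (U : {vspace M}) (b : bool) : {vspace subvs_of U} :=
  (linfun vsval @^-1: smod_part M b)%VS.

Lemma mem_restr_part (F : fieldType) (n : nat) (g : set 'M[F]_(n + n))
    (M : smodule g) (U : {vspace M}) (b : bool) (u : subvs_of U) :
  (u \in restr_part U b) = (vsval u \in smod_part M b).
Proof. by rewrite -memv_preim lfunE. Qed.

Definition stable (F : fieldType) (n : nat) (g : set 'M[F]_(n + n))
    (M : smodule g) (U : {vspace M}) : Prop :=
  forall a x v, g x -> homogeneous a x -> v \in U -> smod_act M x v \in U.

Definition graded (F : fieldType) (n : nat) (g : set 'M[F]_(n + n))
    (M : smodule g) (U : {vspace M}) : Prop :=
  (U <= U :&: smod_part M false + U :&: smod_part M true)%VS.

Definition submodule (F : fieldType) (n : nat) (g : set 'M[F]_(n + n))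
    (M : smodule g) (U : {vspace M}) (sU : stable U) (gU : graded U) :
  smodule g.
Proof.
refine (@SModule F n g (subvs_of U) (restr_part U) (restr_act U) _ _ _ _).
- apply/vspaceP=> u; rewrite memvf.
  have /memv_addP[v0 /memv_capP[Uv0 p0] [v1 /memv_capP[Uv1 p1] Du]] :=
    subvP gU _ (subvsP u).
  apply/memv_addP; exists (vsproj U v0).
    by rewrite mem_restr_part vsprojK.
  exists (vsproj U v1); first by rewrite mem_restr_part vsprojK.
  by apply: val_inj; rewrite /= Du !vsprojK.
- apply/eqP; rewrite -subv0; apply/subvP=> u /memv_capP[].
  rewrite !mem_restr_part => p0 p1.
  have: vsval u \in (smod_part M false :&: smod_part M true)%VS.
    by rewrite memv_cap p0.
  by rewrite smod_direct !memv0 => /eqP u0; apply/eqP/val_inj.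
- move=> a b x u gx hx; rewrite !mem_restr_part => pu.
  rewrite vsval_restr_act; last exact: sU hx (subvsP u).
  exact: smod_act_part.
- move=> a b x y u gx hx gy hy.
  have Uyu := sU _ _ _ gy hy (subvsP u); have Uxu := sU _ _ _ gx hx (subvsP u).
  have Uxyu := sU _ _ _ gx hx Uyu; have Uyxu := sU _ _ _ gy hy Uxu.
  have Ebr := smod_act_bracket (vsval u) gx hx gy hy.
  apply: val_inj; rewrite /= vsval_restr_act; last first.
    by rewrite Ebr rpredB // rpredZ.
  by rewrite Ebr !vsval_restr_act.
Defined.

(** * Weight spaces of a submodule *)

Lemma weight_space_submodule (F : fieldType) (n : nat)
    (g : set 'M[F]_(n + n)) (gH : forall i, g (cartanH F i)) (M : smodule g)
    (U : {vspace M}) (sU : stable U) (gU : graded U) (l : 'rV[F]_n)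
    (u : submodule sU gU) :
  (u \in weight_space (submodule sU gU) l) =
  (vsval (u : subvs_of U) \in weight_space M l).
Proof.
have E i : vsval (restr_act U (cartanH F i) u) =
           smod_act M (cartanH F i) (vsval (u : subvs_of U)).
  rewrite vsval_restr_act //.
  exact (sU false _ _ (gH i) (homogeneous_cartanH F i)
            (subvsP (u : subvs_of U))).
apply/weight_spaceP/weight_spaceP => H i.
  have /(congr1 (fun w : subvs_of U => vsval w)) := H i.
  by rewrite /= E.
by apply: (@val_inj _ _ (subvs_of U)); rewrite /= E H.
Qed.

Lemma dim_weight_space_submodule (F : fieldType) (n : nat)
    (g : set 'M[F]_(n + n)) (gH : forall i, g (cartanH F i)) (M : smodule g)
    (U : {vspace M}) (sU : stable U) (gU : graded U) (l : 'rV[F]_n) :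
  \dim (weight_space (submodule sU gU) l) = \dim (U :&: weight_space M l).
Proof.
pose f : 'Hom(submodule sU gU, M) := linfun (@vsval _ _ U).
rewrite -(limg_dim_eq (f := f)); last first.
  apply/eqP; rewrite -subv0 (eqP (_ : lker f == 0%VS)) ?capvSr //.
  by apply/lker0P => u v; rewrite !lfunE /=; apply: val_inj.
congr (\dim _); apply/vspaceP => v; rewrite memv_cap.
apply/memv_imgP/andP => [[u Wu ->]|[Uv Wv]].
  by rewrite lfunE /= subvsP -weight_space_submodule.
exists (vsproj U v : submodule sU gU); last by rewrite lfunE /= vsprojK.
by rewrite weight_space_submodule // vsprojK.
Qed.

(** * The kernel of the identity matrix *)

Definition ker1 (F : fieldType) (n : nat) (g : set 'M[F]_(n + n))
    (M : smodule g) : {vspace M} := lker (smod_act M 1%:M).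

(** Since I is even and commutes with x, the bracket relation says that the
    actions of I and x commute. *)
Lemma ker1_stable (F : fieldType) (n : nat) (g : set 'M[F]_(n + n))
    (M : smodule g) :
  g 1%:M -> stable (ker1 M).
Proof.
move=> g1 a x v gx hx; rewrite !memv_ker => /eqP v0.
have := smod_act_bracket v g1 (homogeneous_scalar_mx _ 1) gx hx.
rewrite /sbracket /= scale1r mulmx1 mul1mx subrr linear0 lfunE /= v0.
by rewrite linear0 scaler0 subr0 => <-.
Qed.

(** I is even, so it maps the even and the odd component of a vector to
    vectors of the same parities; these sum to zero only if both vanish. *)
Lemma ker1_graded (F : fieldType) (n : nat) (g : set 'M[F]_(n + n))
    (M : smodule g) :
  g 1%:M -> graded (ker1 M).
Proof.
move=> g1; apply/subvP=> v; rewrite memv_ker => /eqP v0.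
have: v \in (smod_part M false + smod_part M true)%VS.
  by rewrite smod_full memvf.
case/memv_addP=> [v' p0 [v'' p1 Dv]].
have q0 := smod_act_part g1 (homogeneous_scalar_mx _ 1) p0.
have q1 := smod_act_part g1 (homogeneous_scalar_mx _ 1) p1.
have E : smod_act M 1%:M v' = - smod_act M 1%:M v''.
  by apply/eqP; rewrite -addr_eq0 -linearD /= -Dv v0.
have: smod_act M 1%:M v' \in (smod_part M false :&: smod_part M true)%VS.
  by rewrite memv_cap q0 E rpredN q1.
rewrite smod_direct memv0 => /eqP z'.
have z'' : smod_act M 1%:M v'' = 0 by rewrite -[LHS]opprK -E z' oppr0.
by apply/memv_addP; exists v'; [|exists v'' => //];
  rewrite memv_cap memv_ker ?z' ?z'' eqxx.
Qed.

(** The terms with nonzero eigenvalue of a sum killed by f must cancel.  To see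
    it without grouping the v i by eigenvalue, apply to the sum the product of
    the operators 1 - (a i)^-1 f: it fixes the kernel of f, hence the sum and
    the terms with a i = 0, and it kills the terms with a i != 0.  The factors
    with a i = 0 are harmless, because the inverse of 0 is 0. *)
Lemma ker_sum_eigenvectors (F : fieldType) (V : vectType F) (f : 'End(V))
    (I : eqType) (s : seq I) (a : I -> F) (v : I -> V) :
  (forall i, f (v i) = a i *: v i) -> f (\sum_(i <- s) v i) = 0 ->
  \sum_(i <- s) v i = \sum_(i <- s | a i == 0) v i.
Proof.
move=> fv f0.
pose p : 'End(V) :=
  foldr (fun i (h : 'End(V)) => (h \o (\1 - (a i)^-1 *: f))%VF) \1%VF s.
have pE j : p (v j) = (\prod_(i <- s) (1 - (a i)^-1 * a j)) *: v j.
  rewrite /p; elim: (s) => [|i t IHt] /=.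
    by rewrite big_nil id_lfunE scale1r.
  rewrite big_cons comp_lfunE add_lfunE opp_lfunE scale_lfunE id_lfunE.
  rewrite fv scalerA.
  by rewrite -[X in X - _]scale1r -scalerBl linearZ /= IHt scalerA.
have p0 : p (\sum_(i <- s) v i) = \sum_(i <- s) v i.
  rewrite /p; elim: {1}s => [|i t IHt] /=; first by rewrite id_lfunE.
  rewrite comp_lfunE add_lfunE opp_lfunE scale_lfunE id_lfunE.
  by rewrite f0 scaler0 subr0.
rewrite -[LHS]p0 linear_sum [RHS]big_mkcond /=.
apply: eq_big_seq => j sj; rewrite pE.
case: eqP => [->|/eqP aj].
  by rewrite big1 ?scale1r // => i _; rewrite mulr0 subr0.
by rewrite (big_rem j) //= mulVf // subrr mul0r scale0r.
Qed.

Definition ker1_module (F : fieldType) (n : nat) (g : set 'M[F]_(n + n))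
    (g1 : g 1%:M) (M : smodule g) : smodule g :=
  submodule (@ker1_stable F n g M g1) (@ker1_graded F n g M g1).

(** Decompose a vector of the kernel into weight vectors of M.  Those whose
    weight has nonzero coordinate sum can be discarded by
    [ker_sum_eigenvectors], and the others are in the kernel. *)
Lemma weight_module_ker1 (F : fieldType) (n : nat) (g : set 'M[F]_(n + n))
    (gH : forall i, g (cartanH F i)) (g1 : g 1%:M) (M : smodule g) :
  weight_module M ->
  weight_module (ker1_module g1 M).
Proof.
case=> s Ms; exists s; apply/vspaceP => u; rewrite memvf.
have: vsval (u : subvs_of (ker1 M)) \in (\sum_(l <- s) weight_space M l)%VS.
  by rewrite Ms memvf.
rewrite (big_nth 0) big_mkord => /memv_sumP[v Wv Du].
have := subvsP (u : subvs_of (ker1 M)); rewrite memv_ker Du => /eqP f0.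
have fv (j : 'I_(size s)) :
    smod_act M 1%:M (v j) = (\sum_(i < n) s`_j 0 i) *: v j.
  by apply: act1_weight; apply: Wv.
have /= Eu := ker_sum_eigenvectors (s := index_enum _) fv f0.
have Kv (j : 'I_(size s)) : \sum_(i < n) s`_j 0 i == 0 -> v j \in ker1 M.
  by move=> /eqP j0; rewrite memv_ker fv j0 scale0r.
have -> : u = \sum_(j < size s | \sum_(i < n) s`_j 0 i == 0)
                 vsproj (ker1 M) (v j) :> subvs_of (ker1 M).
  apply: val_inj; rewrite /= [LHS]Du Eu linear_sum /=.
  by apply: eq_bigr => j j0; rewrite vsprojK ?Kv.
rewrite (big_nth 0) big_mkord; apply: rpred_sum => j j0.
apply: (subvP (sumv_sup j _ (subvv _))) => //.
by rewrite weight_space_submodule // vsprojK ?Kv // Wv.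
Qed.

(** * Truncation to the weights of coordinate sum zero *)

Definition zero_sum_part (F : fieldType) (n : nat) (f : 'rV[F]_n -> int) :
    'rV[F]_n -> int :=
  fun l => if \sum_(i < n) l 0 i == 0 then f l else 0.

Lemma ch_ker1 (F : fieldType) (n : nat) (g : set 'M[F]_(n + n))
    (gH : forall i, g (cartanH F i)) (g1 : g 1%:M) (M : smodule g) :
  ch (ker1_module g1 M) = zero_sum_part (ch M).
Proof.
apply/funext => l; rewrite /ch /zero_sum_part dim_weight_space_submodule //.
case: eqP => [l0|/eqP lN0].
  congr (\dim _)%:Z; apply/capv_idPr/subvP => v Wv.
  by rewrite memv_ker (act1_weight Wv) l0 scale0r.
suff -> : (ker1 M :&: weight_space M l)%VS = 0%VS by rewrite dimv0.
apply/eqP; rewrite -subv0; apply/subvP => v /memv_capP[].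
rewrite memv_ker => /[swap] /act1_weight ->.
by rewrite scaler_eq0 (negPf lN0) memv0.
Qed.

Lemma zero_sum_part_ch (F : fieldType) (n : nat) (g : set 'M[F]_(n + n))
    (M : smodule g) :
  smod_act M 1%:M = 0 -> zero_sum_part (ch M) = ch M.
Proof.
move=> M1; apply/funext => l; rewrite /zero_sum_part /ch.
case: eqP => // /eqP lN0.
suff -> : weight_space M l = 0%VS by rewrite dimv0.
apply/eqP; rewrite -subv0; apply/subvP => v /act1_weight.
rewrite M1 lfunE /= => /esym/eqP.
by rewrite scaler_eq0 (negPf lN0) memv0.
Qed.

Lemma zspan_mono (T : Type) (S S' : set (T -> int)) :
  S `<=` S' -> zspan S `<=` zspan S'.
Proof.
by move=> sS _ [k [c [e [Se ->]]]]; exists k, c, e; split=> // i; apply: sS.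
Qed.

(** Truncation is linear, so it suffices to truncate generators.  The scalar c
    is needed because a truncated monomial may be 0, which is not itself a
    monomial. *)
Lemma zspan_zero_sum_part (F : fieldType) (n : nat)
    (S S' : set ('rV[F]_n -> int)) :
  (forall e, S e ->
    exists c e', S' e' /\ zero_sum_part e = (fun l => c * e' l)) ->
  forall f, zspan S f -> zspan S' (zero_sum_part f).
Proof.
move=> SS' _ [k [c [e [Se ->]]]].
have /choice[d Hd] (i : 'I_k) : exists d : int * ('rV[F]_n -> int),
    S' d.2 /\ zero_sum_part (e i) = (fun l => d.1 * d.2 l).
  by have [c' [e' ?]] := SS' _ (Se i); exists (c', e').
exists k, (fun i => c i * (d i).1), (fun i => (d i).2); split=> [i|].
  by have [] := Hd i.
apply/funext => l.
have -> : zero_sum_part (fun t => \sum_(i < k) c i * e i t) l =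
          \sum_(i < k) c i * zero_sum_part (e i) l.
  rewrite /zero_sum_part; case: ifP => // _.
  by rewrite big1 // => i _; exact: mulr0.
by apply: eq_bigr => i _; have [_ ->] := Hd i; rewrite mulrA.
Qed.

Lemma zero_sum_part_zspan (F : fieldType) (n : nat)
    (S : set ('rV[F]_n -> int)) :
  (forall e, S e -> zero_sum_part e = e) ->
  forall f, zspan S f -> zero_sum_part f = f.
Proof.
move=> SS _ [k [c [e [Se ->]]]]; apply/funext => l; rewrite /zero_sum_part.
case: ifP => // l0; rewrite big1 // => i _.
by rewrite -(SS _ (Se i)) /zero_sum_part l0 mulr0.
Qed.

Lemma zero_sum_part_xpow (R : realType) (n : nat) (l : 'rV[int]_n) :
  zero_sum_part (xpow R l) =
  (fun m => (\sum_(i < n) l 0 i == 0)%:R * xpow R l m).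
Proof.
apply/funext => m; rewrite /zero_sum_part /xpow /expw.
case: (m =P _) => [->|_]; last by rewrite mulr0 if_same.
under eq_bigr do rewrite mxE.
by rewrite -rmorph_sum /= intr_eq0 mulr1; case: (_ == 0).
Qed.

(** * Characters modulo the scalar matrices *)

Lemma char_ring_mod_scalars (R : realType) (n : nat)
    (g : set 'M[complex R]_(n + n)) :
  (forall i, g (cartanH _ i)) -> g 1%:M ->
  char_ring g (CI R n) `&` laurent R n =
  char_ring g [set 0] `&`
    zspan [set xpow R l | l in [set l : 'rV[int]_n | \sum_(i < n) l 0 i = 0]].
Proof.
move=> gH g1; apply/seteqP; split=> f [Jf Lf].
  have f0 : zero_sum_part f = f.
    apply: zero_sum_part_zspan Jf => _ [M [_ kM ->]]; apply: zero_sum_part_ch.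
    by apply: kM; exists 1.
  split.
    apply: zspan_mono Jf => _ [M [wM _ ->]]; exists M; split=> // x ->.
    exact: linear0.
  rewrite -f0; apply: zspan_zero_sum_part Lf => _ [l _ <-].
  rewrite zero_sum_part_xpow; case: (\sum_(i < n) _ =P 0) => [l0|_].
    by exists 1, (xpow R l); split=> //; exists l.
  (* The truncation is 0, so any monomial of degree zero serves. *)
  exists 0, (xpow R 0); split; last by apply/funext => m; rewrite !mul0r.
  by exists 0 => //; rewrite /mkset /= big1 // => i _; rewrite mxE.
split; last by apply: zspan_mono Lf => _ [l _ <-]; exists l.
have <- : zero_sum_part f = f.
  apply: zero_sum_part_zspan Lf => _ [l /= l0 <-].
  by rewrite zero_sum_part_xpow l0 eqxx; apply/funext => m; rewrite mul1r.
apply: zspan_zero_sum_part Jf => _ [M [wM _ ->]].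
exists 1, (zero_sum_part (ch M)); split; last first.
  by apply/funext => l; rewrite mul1r.
exists (ker1_module g1 M); split.
- exact: weight_module_ker1.
- move=> _ [a ->]; apply/lfunP => u; rewrite zero_lfunE.
  have au : smod_act M a%:M (vsval (u : subvs_of (ker1 M))) = 0.
    have := subvsP (u : subvs_of (ker1 M)); rewrite memv_ker => /eqP u0.
    by rewrite -scalemx1 linearZ scale_lfunE [X in a *: X]u0 scaler0.
  by apply: (@val_inj _ _ (subvs_of (ker1 M)));
    rewrite /= vsval_restr_act au ?mem0v.
- by rewrite ch_ker1.
Qed.

Theorem corollary15 (R : realType) (n : nat) :
  J_pq R n `&` laurent R n =
    J_q R n `&`
    zspan [set xpow R l | l in [set l : 'rV[int]_n | \sum_(i < n) l 0 i = 0]]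
  /\
  J_psq R n `&` laurent R n =
    J_sq R n `&`
    zspan [set xpow R l | l in [set l : 'rV[int]_n | \sum_(i < n) l 0 i = 0]].
Proof.
split; apply: char_ring_mod_scalars => [i|].
- by exists (delta_mx i i), 0; rewrite cartanHE.
- by exists 1%:M, 0; rewrite scalar_mx_block.
- by exists (delta_mx i i), 0; rewrite mxtrace0 cartanHE.
- by exists 1%:M, 0; rewrite mxtrace0 scalar_mx_block.
Qed.
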